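(* Let $a,b,t$ be complex numbers. Let $f_3(z,a,b)=\sum_{n\ge0}c(n,3,a,b)z^n$ be the unique formal power series with $f_3=1+azf_3+bz^3f_3^2$, and define $C(n,3,a,b,t)$ by $\sum_{n\ge0}C(n,3,a,b,t)z^n=\frac{f_3}{1-tzf_3}$. Let $d_0^{(3)}(N,a,b)=\det\big(c(i+j,3,a,b)\big)_{i,j=0}^{N-1}$ and $D_0^{(3)}(N,a,b,t)=\det\big(C(i+j,3,a,b,t)\big)_{i,j=0}^{N-1}$. Then for all $n\ge0$ $$d_0^{(3)}(3n,a,b)=(-1)^nb^{n(3n-1)},\quad d_0^{(3)}(3n+1,a,b)=(-1)^nb^{n(3n+1)},\quad d_0^{(3)}(3n+2,a,b)=0,$$ and $D_0^{(3)}(N,a,b,t)=d_0^{(3)}(N,a,b)$ for all $N\ge0$.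
   Context: The determinant of a $0\times0$ matrix is $1$. *)

(* Defs.v *)
From mathcomp Require Import all_boot all_order all_algebra.
From mathcomp Require Export reals complex.

Set Implicit Arguments.
Unset Strict Implicit.
Unset Printing Implicit Defensive.

Import GRing.Theory.
Local Open Scope ring_scope.

(* The series \sum_n f n * z ^ n is identified with f; equality is [=1]. *)
Definition fps (K : nzRingType) := nat -> K.

Declare Scope fps_scope.
Delimit Scope fps_scope with fps.
Bind Scope fps_scope with fps.

Section Operations.
Variable K : nzRingType.
Implicit Types f g : fps K.

(* fps_mono c k is the monomial c * z ^ k *)
Definition fps_mono (c : K) (k : nat) : fps K :=
  fun n => if n == k then c else 0.
Definition fps_add f g : fps K := fun n => f n + g n.
Definition fps_sub f g : fps K := fun n => f n - g n.
Definition fps_mul f g : fps K := fun n => \sum_(i < n.+1) f i * g (n - i)%N.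

(* The solution of f = Phi f, when the n-th coefficient of Phi f only depends
   on the coefficients of f of index less than n; see fps_fixP. *)
Definition fps_fix (Phi : fps K -> fps K) : fps K :=
  fun n => iter n.+1 Phi (fun=> 0) n.

Definition fps_causal (Phi : fps K -> fps K) :=
  forall n f g, (forall k, (k < n)%N -> f k = g k) -> Phi f n = Phi g n.

Lemma fps_fixP Phi : fps_causal Phi -> fps_fix Phi =1 Phi (fps_fix Phi).
Proof.
move=> cPhi n.
have stab m m' k : (k < m)%N -> (k < m')%N ->
    iter m Phi (fun=> 0) k = iter m' Phi (fun=> 0) k.
  elim: m m' k => [//|m IHm] [//|m'] k; rewrite !ltnS => lekm lekm' /=.
  by apply: cPhi => j ltjk; apply: IHm; apply: leq_trans ltjk _.
by rewrite {1}/fps_fix /=; apply: cPhi => k ltkn; apply: stab.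
Qed.

Lemma fps_fix_unique Phi f :
  fps_causal Phi -> f =1 Phi f -> f =1 fps_fix Phi.
Proof.
move=> cPhi fE n; elim/ltn_ind: n => n IHn.
by rewrite fE fps_fixP //; apply: cPhi.
Qed.

End Operations.

Notation "c *z^ k" := (fps_mono c%R k%N)
  (at level 30, k at level 8, format "c  *z^ k") : fps_scope.
Notation "1" := (fps_mono 1%R 0%N) : fps_scope.
Notation "f + g" := (fps_add f g) : fps_scope.
Notation "f - g" := (fps_sub f g) : fps_scope.
Notation "f * g" := (fps_mul f g) : fps_scope.

(* The coefficients h n of 1 / g, from
   g 0 * h n + \sum_(1 <= j < n.+1) g j * h (n - j) = (n == 0). *)
Definition fps_inv (K : unitRingType) (g : fps K) : fps K :=
  fps_fix (fun h n =>
    (g 0%N)^-1 * ((n == 0%N)%:R - \sum_(i < n) g i.+1 * h (n - i.+1)%N)).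

Definition fps_div (K : unitRingType) (f g : fps K) : fps K :=
  fps_mul f (fps_inv g).

Notation "f / g" := (fps_div f g) : fps_scope.

Lemma fps_mulV (K : unitRingType) (g : fps K) :
  g 0%N \is a GRing.unit -> (g * fps_inv g =1 1)%fps.
Proof.
move=> g0 n; rewrite /fps_mul big_ord_recl subn0.
rewrite {1}/fps_inv fps_fixP; last first.
  move=> m h h' eqh; congr (_ * (_ - _)); apply: eq_bigr => i _.
  by rewrite eqh // ltn_subrL (leq_ltn_trans _ (ltn_ord i)).
by rewrite mulrA divrr // mul1r subrK /fps_mono; case: (n == 0%N).
Qed.

Lemma fps_monoM (K : nzRingType) (c : K) k (f : fps K) n :
  (c *z^ k * f)%fps n = if (k <= n)%N then c * f (n - k)%N else 0.
Proof.
rewrite /fps_mul /fps_mono; case: leqP => [lekn|ltnk].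
  rewrite (bigD1 (Ordinal (lekn : (k < n.+1)%N))) //= eqxx big1 ?addr0 //.
  move=> i; rewrite -val_eqE /= => /negPf ->; by rewrite mul0r.
rewrite big1 // => i _; case: eqP => [ik|]; last by rewrite mul0r.
by have := ltn_ord i; rewrite ik ltnS leqNgt ltnk.
Qed.

Lemma f3_exists_unique (K : nzRingType) (a b : K) :
  let Phi (f : fps K) := (1 + a *z^ 1 * f + b *z^ 3 * (f * f))%fps in
  exists2 f, f =1 Phi f & forall g, g =1 Phi g -> g =1 f.
Proof.
move=> Phi.
have cPhi : fps_causal Phi.
  move=> n f g eqfg; rewrite /Phi /fps_add !fps_monoM.
  congr (_ + _ + _); case: ifP => // len.
    by rewrite eqfg // ltn_subrL.
  congr (_ * _); apply: eq_bigr => i _.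
  have lt3 : (n - 3 < n)%N by rewrite ltn_subrL (leq_trans _ len).
  rewrite !eqfg //; first by rewrite (leq_ltn_trans (leq_subr _ _)).
  by apply: leq_ltn_trans lt3; rewrite -ltnS.
exists (fps_fix Phi); first exact: fps_fixP.
by move=> g; apply: fps_fix_unique.
Qed.

Definition hankel_det (K : comNzRingType) (c : fps K) (N : nat) : K :=
  \det (\matrix_(i < N, j < N) c (i + j)%N).

(* Main.v *)
(** Write [h(x, y) = \sum_(i, j) c (i + j) x^i y^j] for the bivariate generating
    function of the Hankel matrix of [c(z)]; it is characterised by
    [(x - y) h(x, y) = x c(x) - y c(y)].  If [u 0 = 1], multiplying a bivariate
    series by [u(x) u(y)] is a congruence of the coefficient matrix by a
    unitriangular Toeplitz matrix and preserves all leading principal minors.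
    Let [H] and [G] be the Hankel series of [f] and [z f].  The functional
    equation gives
      [H = f(x) f(y) (1 + b x y G)] and
      [G = f(x) f(y) (x + y - a x y + b x^2 y^2 H)],
    and the matrices of the factors in parentheses are block diagonal.  Hence
    [d (N + 3) = - b^(2 N + 2) d N].  Similarly the Hankel series of
    [f / (1 - t z f)] is [u(x) u(y) H] with [u = 1 / (1 - t z f)]. *)

Require Import Defs.
From HB Require Import structures.
From mathcomp Require Import all_boot all_order all_algebra.
From mathcomp Require Import boolp ring zify.
Set Implicit Arguments.
Unset Strict Implicit.
Unset Printing Implicit Defensive.
Import GRing.Theory.
Local Open Scope ring_scope.

(** * The ring of formal power series *)

Section Ring.
Variable K : comNzRingType.
Implicit Types f g h : fps K.

HB.instance Definition _ := gen_eqMixin (fps K).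
HB.instance Definition _ := gen_choiceMixin (fps K).

Definition fps_zero : fps K := fun=> 0.
Definition fps_opp f : fps K := fun n => - f n.

Fact fps_addA : associative (@fps_add K).
Proof. by move=> f g h; apply/funext => n; rewrite /fps_add addrA. Qed.
Fact fps_addC : commutative (@fps_add K).
Proof. by move=> f g; apply/funext => n; rewrite /fps_add addrC. Qed.
Fact fps_add0 : left_id fps_zero (@fps_add K).
Proof. by move=> f; apply/funext => n; rewrite /fps_add add0r. Qed.
Fact fps_addN : left_inverse fps_zero fps_opp (@fps_add K).
Proof. by move=> f; apply/funext => n; rewrite /fps_add addNr. Qed.

HB.instance Definition _ :=
  GRing.isZmodule.Build (fps K) fps_addA fps_addC fps_add0 fps_addN.

(** Coefficient [n] of a product involves only coefficients of index at most [n], so truncating to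
    polynomials loses nothing. Commutativity and associativity are thus inherited from
    polynomials. *)
Lemma fps_mul_poly f g n m : (n < m)%N ->
  fps_mul f g n = ((\poly_(i < m) f i) * (\poly_(i < m) g i))`_n.
Proof.
move=> ltnm; rewrite coefM; apply: eq_bigr => i _.
have lei : (i <= n)%N by rewrite -ltnS.
rewrite !coef_poly (leq_ltn_trans lei ltnm).
by rewrite (leq_ltn_trans (leq_subr _ _) ltnm).
Qed.

Fact fps_mulC : commutative (@fps_mul K).
Proof.
by move=> f g; apply/funext => n; rewrite !(fps_mul_poly _ _ (ltnSn n)) mulrC.
Qed.

Fact fps_mulA : associative (@fps_mul K).
Proof.
move=> f g h; apply/funext => n.
pose p (u : fps K) := \poly_(i < n.+1) u i.
have lei (i : 'I_n.+1) : (i < n.+1)%N by [].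
transitivity (p f * p g * p h)`_n; last first.
  rewrite coefM; apply: eq_bigr => i _.
  by rewrite -fps_mul_poly // coef_poly ltnS leq_subr.
rewrite -mulrA coefM; apply: eq_bigr => i _.
by rewrite -fps_mul_poly ?ltnS ?leq_subr // coef_poly lei.
Qed.

Fact fps_mul1 : left_id (fps_mono (1 : K) 0) (@fps_mul K).
Proof. by move=> f; apply/funext => n; rewrite fps_monoM subn0 mul1r. Qed.

Fact fps_mulDl : left_distributive (@fps_mul K) (@fps_add K).
Proof.
move=> f g h; apply/funext => n; rewrite /fps_add /fps_mul -big_split /=.
by apply: eq_bigr => i _; rewrite mulrDl.
Qed.

Fact fps_one_neq0 : fps_mono (1 : K) 0 != 0 :> fps K.
Proof.
by apply/eqP => /(congr1 (fun f : fps K => f 0%N)) /eqP; rewrite oner_eq0.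
Qed.

HB.instance Definition _ := GRing.Zmodule_isComNzRing.Build (fps K)
  fps_mulA fps_mulC fps_mul1 fps_mulDl fps_one_neq0.

Lemma fps_addE f g n : (f + g)%R n = f n + g n. Proof. by []. Qed.
Lemma fps_oppE f n : (- f)%R n = - f n. Proof. by []. Qed.
Lemma fps_mulE f g n : (f * g)%R n = \sum_(i < n.+1) f i * g (n - i)%N.
Proof. by []. Qed.

Lemma fps_sumE (I : Type) (r : seq I) (P : pred I) (F : I -> fps K) n :
  (\sum_(i <- r | P i) F i)%R n = \sum_(i <- r | P i) F i n.
Proof. by elim/big_rec2: _ => // i x y _ <-. Qed.

Definition fpsC (c : K) : fps K := fps_mono c 0.
Definition fpsX : fps K := fps_mono 1 1.

Lemma fpsCM c f n : (fpsC c * f)%R n = c * f n.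
Proof. by have := fps_monoM c 0 f n; rewrite subn0. Qed.

Lemma fpsXM0 f : (fpsX * f)%R 0%N = 0.
Proof. exact: (fps_monoM 1 1 f 0). Qed.

Lemma fpsXMS f n : (fpsX * f)%R n.+1 = f n.
Proof. by have := fps_monoM 1 1 f n.+1; rewrite /= subn1 mul1r. Qed.

Fact fpsC_is_zmod_morphism : zmod_morphism fpsC.
Proof.
by move=> c d; apply/funext => -[|n]; rewrite fps_addE fps_oppE //= subr0.
Qed.

Fact fpsC_is_monoid_morphism : monoid_morphism fpsC.
Proof.
split=> // c d; apply/funext => n.
by rewrite fpsCM /fpsC /fps_mono; case: ifP; rewrite ?mulr0.
Qed.

HB.instance Definition _ :=
  GRing.isZmodMorphism.Build K (fps K) fpsC fpsC_is_zmod_morphism.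
HB.instance Definition _ :=
  GRing.isMonoidMorphism.Build K (fps K) fpsC fpsC_is_monoid_morphism.

Lemma fps_monoE (c : K) k : fps_mono c k = fpsC c * fpsX ^+ k.
Proof.
apply/funext => n; rewrite fpsCM.
elim: k n => [|k IHk] [|n];
  rewrite ?expr0 ?exprS ?fpsXM0 ?fpsXMS -?IHk ?mulr0 //.
exact/esym/mulr1.
Qed.

End Ring.

(** * Bivariate series *)

Section Bivariate.
Variable K : comNzRingType.
Implicit Types (c u f : fps K) (A B : fps (fps K)).

(* The coefficient of [x^i y^j] in [A] is [A i j]. *)
Definition inx c : fps (fps K) := fun i => fpsC (c i).
Definition iny c : fps (fps K) := fpsC c.

Fact inx_is_zmod_morphism : zmod_morphism inx.
Proof. by move=> c d; apply/funext => n; rewrite /inx fps_addE rmorphB. Qed.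

Fact inx_is_monoid_morphism : monoid_morphism inx.
Proof.
split=> [|c d]; apply/funext => n; rewrite /inx.
  by case: n => // n; exact: (raddf0 (@fpsC K)).
by rewrite !fps_mulE rmorph_sum; apply: eq_bigr => i _; rewrite rmorphM.
Qed.

HB.instance Definition _ := GRing.isZmodMorphism.Build (fps K) (fps (fps K))
  inx inx_is_zmod_morphism.
HB.instance Definition _ := GRing.isMonoidMorphism.Build (fps K) (fps (fps K))
  inx inx_is_monoid_morphism.
HB.instance Definition _ := GRing.isZmodMorphism.Build (fps K) (fps (fps K))
  iny (@fpsC_is_zmod_morphism _).
HB.instance Definition _ := GRing.isMonoidMorphism.Build (fps K) (fps (fps K))
  iny (@fpsC_is_monoid_morphism _).

Lemma inx_iny_const (k : K) : inx (fpsC k) = iny (fpsC k).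
Proof. by apply/funext => -[|n] //; exact: (raddf0 (@fpsC K)). Qed.

Lemma inx_fpsX : inx (fpsX K) = fpsX (fps K).
Proof. by apply/funext => -[|[|n]] //; exact: (raddf0 (@fpsC K)). Qed.

Lemma inxXM0 A j : (inx (fpsX K) * A)%R 0%N j = 0.
Proof. by rewrite inx_fpsX fpsXM0. Qed.

Lemma inxXMS A i j : (inx (fpsX K) * A)%R i.+1 j = A i j.
Proof. by rewrite inx_fpsX fpsXMS. Qed.

Lemma inyXM0 A i : (iny (fpsX K) * A)%R i 0%N = 0.
Proof. by rewrite fpsCM fpsXM0. Qed.

Lemma inyXMS A i j : (iny (fpsX K) * A)%R i j.+1 = A i j.
Proof. by rewrite fpsCM fpsXMS. Qed.

Lemma constM (k : K) A i j : (iny (fpsC k) * A)%R i j = k * A i j.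
Proof. by rewrite !fpsCM. Qed.

(** Cancellation of [x - y] over any commutative ring: the coefficient of [x^(i+1) y^j] in
    [(x - y) A] is [A i j - A (i+1) (j-1)], or just [A i 0] when [j = 0], so each column of [A] is
    recovered from the previous one. *)
Lemma inx_subr_iny_inj A B :
  (inx (fpsX K) - iny (fpsX K)) * A = (inx (fpsX K) - iny (fpsX K)) * B -> A = B.
Proof.
rewrite !mulrBl => eqAB; apply/funext => i; apply/funext => j.
elim: j i => [|j IHj] i; have := congr1 (fun C => (C : fps (fps K)) i.+1) eqAB.
  move/(congr1 (fun c => c 0%N)).
  by rewrite !fps_addE !fps_oppE !inyXM0 !inxXMS !subr0.
move/(congr1 (fun c => c j.+1)).
by rewrite !fps_addE !fps_oppE !inyXMS !inxXMS IHj => /addIr.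
Qed.

Definition leading_minor A N : K := \det (\matrix_(i < N, j < N) A i j).

Lemma leading_minor_congruence u A N : u 0%N = 1 ->
  leading_minor (inx u * iny u * A)%R N = leading_minor A N.
Proof.
move=> u0.
pose T : 'M[K]_N := \matrix_(i, k) if (k <= i)%N then u (i - k)%N else 0.
have detT : \det T = 1.
  rewrite det_trig.
    by rewrite big1 // => i _; rewrite mxE leqnn subnn.
  by apply/is_trig_mxP => i j ltij; rewrite mxE leqNgt ltij.
(* The zeros of [T] above the diagonal extend the convolution to all [k < N]. As only indices up to
   [i] contribute, cutting to size [N] is compatible with the product. *)
have convE (F : nat -> K) (i : 'I_N) :
    \sum_(k < i.+1) F k * u (i - k)%N = \sum_(k < N) F k * T i k.
  rewrite (big_ord_widen_cond N xpredT (fun k => F k * u (i - k)%N)) //=.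
  rewrite big_mkcond /=; apply: eq_bigr => k _.
  by rewrite mxE ltnS; case: ifP; rewrite ?mulr0.
pose M B : 'M[K]_N := \matrix_(i, j) B i j.
have -> : leading_minor (inx u * iny u * A)%R N = \det (T *m M A *m T^T).
  congr (\det _); rewrite -mulmxA; apply/matrixP => i j; rewrite !mxE.
  rewrite -mulrA mulrC fps_mulE fps_sumE.
  transitivity (\sum_(k < i.+1) (iny u * A)%R k j * u (i - k)%N).
    by apply: eq_bigr => k _; rewrite /inx mulrC fpsCM mulrC.
  rewrite (convE (fun k => (iny u * A)%R k j)); apply: eq_bigr => k _.
  rewrite mulrC; congr (_ * _); rewrite fpsCM (mulrC u) fps_mulE (convE (A k)).
  by rewrite mxE; apply: eq_bigr => l _; rewrite !mxE.
by rewrite !det_mulmx det_tr detT mul1r mulr1.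
Qed.

(** The upper right block vanishes, so the lower left one does not affect the determinant; [k ^+ n]
    comes from scaling the [n] rows of the last block. *)
Lemma leading_minor_block m n A B (k : K) :
    (forall i j, (i < m)%N -> A i (m + j)%N = 0) ->
    (forall i j, A (m + i)%N (m + j)%N = k * B i j) ->
  leading_minor A (m + n) = leading_minor A m * (k ^+ n * leading_minor B n).
Proof.
move=> A0 AB; rewrite /leading_minor -[X in \det X = _]submxK.
set M := \matrix_(i, j) _; have -> : ursubmx M = 0.
  by apply/matrixP => i j; rewrite !mxE /= A0.
rewrite det_lblock; congr (_ * _).
  by congr (\det _); apply/matrixP => i j; rewrite !mxE.
by rewrite -detZ; congr (\det _); apply/matrixP => i j; rewrite !mxE /= AB.
Qed.

Lemma leading_minor1 A : leading_minor A 1 = A 0%N 0%N.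
Proof. by rewrite /leading_minor det_mx11 mxE. Qed.

Lemma leading_minor2 A :
  leading_minor A 2 = A 0%N 0%N * A 1%N 1%N - A 0%N 1%N * A 1%N 0%N.
Proof.
rewrite /leading_minor (expand_det_row _ ord0) !big_ord_recl big_ord0 addr0.
rewrite /cofactor !det_mx11 !mxE /=.
by rewrite expr0 expr1 mul1r mulN1r mulrN.
Qed.

Definition hankel_series c : fps (fps K) := fun i j => c (i + j)%N.

(** Away from the axes, [x h] and [y h] both have coefficient [c (i + j - 1)] and cancel; only the
    terms with [i = 0] or [j = 0] survive. *)
Lemma hankel_seriesE c :
  (inx (fpsX K) - iny (fpsX K)) * hankel_series c
  = inx (fpsX K) * inx c - iny (fpsX K) * iny c.
Proof.
rewrite mulrBl; apply/funext => i; apply/funext => j.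
rewrite !fps_addE !fps_oppE.
case: i j => [|i] [|j]; rewrite ?inxXM0 ?inxXMS ?inyXM0 ?inyXMS //.
- by rewrite /hankel_series /inx /= addn0.
- by rewrite /hankel_series addnS subrr sub0r oppr0.
Qed.

End Bivariate.

(** * Hankel determinants *)

Section Hankel.
Variables (K : comNzRingType) (a b : K) (f : fps K).
Hypothesis fE : f = 1 + fpsC a * fpsX K * f + fpsC b * fpsX K ^+ 3 * (f * f).

Let x := inx (fpsX K).
Let y := iny (fpsX K).
Let fx := inx f.
Let fy := iny f.
Let ca := iny (fpsC a).
Let cb := iny (fpsC b).

(** The equations for [fx] and [fy] are put in the form [_ = 0] so that multiples of them can be
    added to a side of an identity before [ring] is called. *)
Let fxE : fx - (1 + ca * x * fx + cb * x ^+ 3 * (fx * fx)) = 0.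
Proof.
apply/eqP; rewrite subr_eq0; apply/eqP.
by rewrite {1}/fx fE !rmorphD !rmorphM !rmorph1 /= !inx_iny_const.
Qed.

Let fyE : fy - (1 + ca * y * fy + cb * y ^+ 3 * (fy * fy)) = 0.
Proof.
apply/eqP; rewrite subr_eq0; apply/eqP.
by rewrite {1}/fy fE !rmorphD !rmorphM !rmorph1.
Qed.

Let f0 : f 0%N = 1.
Proof.
by rewrite fE !fps_addE -!mulrA !fpsCM !fpsXM0 !mulr0 !addr0.
Qed.

Let H := hankel_series f.
Let G := hankel_series (fpsX K * f)%R.

Let HE : H = fx * fy * (1 + cb * (x * (y * G))).
Proof.
apply: inx_subr_iny_inj; rewrite -/x -/y hankel_seriesE -/x -/y -/fx -/fy.
transitivity (fx * fy * (x - y + cb * (x * (y * ((x - y) * G))))); last by ring.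
rewrite hankel_seriesE !rmorphM /= -/x -/y -/fx -/fy.
(* Adding [- y fy] times the equation of [fx] and [x fx] times that of [fy] cancels [x fx - y fy]
   and the terms in [a], leaving [fx fy (x - y)] and the terms in [b]. *)
rewrite -[LHS]addr0 -[X in _ + X](mulr0 (- y * fy)) -fxE.
rewrite -[LHS]addr0 -[X in _ + X](mulr0 (x * fx)) -fyE.
by ring.
Qed.

Let GE :
  G = fx * fy * (x + y - ca * (x * y) + cb * (x * (x * (y * (y * H))))).
Proof.
apply: inx_subr_iny_inj; rewrite -/x -/y hankel_seriesE.
rewrite !rmorphM /= -/x -/y -/fx -/fy.
transitivity (fx * fy * ((x - y) * (x + y - ca * (x * y))
  + cb * (x * (x * (y * (y * ((x - y) * H))))))); last by ring.
rewrite hankel_seriesE -/x -/y -/fx -/fy.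
rewrite -[LHS]addr0 -[X in _ + X](mulr0 (- y ^+ 2 * fy)) -fxE.
rewrite -[LHS]addr0 -[X in _ + X](mulr0 (x ^+ 2 * fx)) -fyE.
by ring.
Qed.

Lemma hankel_det_S N :
  hankel_det f N.+1 = b ^+ N * hankel_det (fpsX K * f)%R N.
Proof.
rewrite -[LHS]/(leading_minor H N.+1) HE leading_minor_congruence // -add1n.
rewrite (@leading_minor_block _ 1 N _ G b).
- by rewrite leading_minor1 !fps_addE constM inxXM0 mulr0 addr0 mul1r.
- by case=> // j _; rewrite !fps_addE constM inxXM0 mulr0 addr0.
- move=> i j; rewrite !add1n !fps_addE constM inxXMS inyXMS.
  exact: add0r.
Qed.

Lemma hankel_det_shift_SS N :
  hankel_det (fpsX K * f)%R N.+2 = - b ^+ N * hankel_det f N.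
Proof.
rewrite -[LHS]/(leading_minor G N.+2) GE leading_minor_congruence //.
(* The factors [1] give every monomial the shape to which the coefficient rules for multiplication
   by [x] and [y] apply. *)
have -> : x + y - ca * (x * y) = x * 1 + y * 1 - ca * (x * (y * 1)).
  by rewrite !mulr1.
have one0 j : (1%R : fps (fps K)) 0%N j = (j == 0%N)%:R by case: j.
have oneS i j : (1%R : fps (fps K)) i.+1 j = 0 by [].
have coefE i j : (x * 1 + y * 1 - ca * (x * (y * 1)) +
    cb * (x * (x * (y * (y * H)))))%R i j =
  (x * 1)%R i j + (y * 1)%R i j - a * (x * (y * 1))%R i j
    + b * (x * (x * (y * (y * H))))%R i j.
  by rewrite !fps_addE !fps_oppE !constM.
have simp := (inxXM0, inxXMS, inyXM0, inyXMS, one0, oneS).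
rewrite -add2n (@leading_minor_block _ 2 N _ H b).
(* The leading block has rows [(0, 1)] and [(1, -a)], hence determinant [-1]. *)
- rewrite leading_minor2 !coefE !simp /= /leading_minor /hankel_det.
  by ring.
- by move=> [|[|i]] // j _; rewrite !add2n !coefE !simp /=; ring.
- by move=> i j; rewrite !add2n coefE !simp; ring.
Qed.

Lemma hankel_det_SSS N :
  hankel_det f N.+3 = - b ^+ (2 * N + 2) * hankel_det f N.
Proof.
rewrite hankel_det_S hankel_det_shift_SS !mulNr mulrN mulrA -exprD.
by congr (- (b ^+ _ * _)); lia.
Qed.

Lemma hankel_det_values n :
  [/\ hankel_det f (3 * n) = (-1) ^+ n * b ^+ (n * (3 * n - 1)),
      hankel_det f (3 * n + 1) = (-1) ^+ n * b ^+ (n * (3 * n + 1))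
    & hankel_det f (3 * n + 2) = 0].
Proof.
(* Going from [n] to [n + 1], the exponent of [b] grows by [2 (3n) + 2 = 6n + 2] in the first case
   and by [2 (3n + 1) + 2 = 6n + 4] in the second. *)
have step N m p q : hankel_det f N = (-1) ^+ m * b ^+ p ->
    (q = p + (2 * N + 2))%N -> hankel_det f N.+3 = (-1) ^+ m.+1 * b ^+ q.
  move=> dN ->; rewrite hankel_det_SSS dN exprS mulN1r !mulNr.
  by rewrite mulrCA -exprD [(_ + p)%N]addnC.
elim: n => [|n [IH0 IH1 IH2]].
  (* At [n = 0] the truncated subtraction in [3 * n - 1] is harmless, being multiplied by [n]. *)
  split; first by rewrite !muln0 !expr0 mulr1 /hankel_det det_mx00.
    by rewrite hankel_det_S /hankel_det det_mx00 !expr0.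
  (* The determinant of order 2 is [b] times the constant term of [z f], which is 0. *)
  rewrite hankel_det_S -[hankel_det _ 1]/(leading_minor G 1) leading_minor1.
  by rewrite /G /hankel_series fpsXM0 mulr0.
rewrite mulnS !addSn; split.
- by apply: (step _ _ _ _ IH0); nia.
- by apply: (step _ _ _ _ IH1); nia.
- by rewrite hankel_det_SSS IH2 mulr0.
Qed.

End Hankel.

(** Over a common denominator, the cross terms [t x y f(x) f(y)] cancel in [x f(x) / (1 - t x f(x))
    - y f(y) / (1 - t y f(y))], leaving [u(x) u(y) (x f(x) - y f(y))]. *)
Lemma hankel_det_invariant (K : comNzRingType) (t : K) (f u : fps K) N :
    (1 - fpsC t * fpsX K * f) * u = 1 ->
  hankel_det (f * u)%R N = hankel_det f N.
Proof.
move=> uE.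
have {}uE : u - (1 + fpsC t * fpsX K * f * u) = 0 by rewrite -uE; ring.
have u0 : u 0%N = 1.
  move/eqP: uE; rewrite subr_eq0 => /eqP ->.
  by rewrite fps_addE -!mulrA fpsCM fpsXM0 mulr0 addr0.
have /esym uxE := congr1 (@inx K) uE; have /esym uyE := congr1 (@iny K) uE.
rewrite rmorphB rmorphD !rmorphM !rmorph1 rmorph0 /= inx_iny_const in uxE.
rewrite rmorphB rmorphD !rmorphM !rmorph1 rmorph0 /= in uyE.
rewrite -[LHS]/(leading_minor (hankel_series (f * u)%R) N).
rewrite -[RHS]/(leading_minor (hankel_series f) N).
rewrite -(leading_minor_congruence (hankel_series f) N u0).
congr (leading_minor _ N); apply: inx_subr_iny_inj.
rewrite mulrCA !hankel_seriesE !rmorphM /=.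
set x := inx (fpsX K) in uxE *; set y := iny (fpsX K) in uyE *.
set fx := inx f in uxE *; set fy := iny f in uyE *.
set ux := inx u in uxE *; set uy := iny u in uyE *.
(* The multipliers [- y fy uy] and [x fx ux] of the two equations for [u] perform this cancellation
   without division. *)
rewrite -[LHS]addr0 -[X in _ + X](mulr0 (- y * fy * uy)) uxE.
rewrite -[LHS]addr0 -[X in _ + X](mulr0 (x * fx * ux)) uyE.
by ring.
Qed.

Theorem theorem6p1 (R : realType) (a b t : R[i]) (f F : fps R[i])
    (hf : (f =1 1 + a *z^ 1 * f + b *z^ 3 * (f * f))%fps)
    (hF : (F =1 f / (1 - t *z^ 1 * f))%fps) :
  (forall n : nat,
     [/\ hankel_det f (3 * n) = (-1) ^+ n * b ^+ (n * (3 * n - 1)),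
         hankel_det f (3 * n + 1) = (-1) ^+ n * b ^+ (n * (3 * n + 1))
       & hankel_det f (3 * n + 2) = 0])
  /\ (forall N : nat, hankel_det F N = hankel_det f N).
Proof.
split.
  apply: (@hankel_det_values _ a).
  by move/funext: hf; rewrite (fps_monoE a) (fps_monoE b) expr1.
move=> N; rewrite (funext hF); apply: (@hankel_det_invariant _ t).
(* The constant term is 1 for every [t], so [fps_inv] yields a genuine inverse of the
   denominator. *)
have : (1 - t *z^ 1 * f)%fps 0%N \is a GRing.unit.
  by rewrite /fps_sub fps_monoM subr0 unitr1.
by move/fps_mulV/funext; rewrite (fps_monoE t) expr1.
Qed.
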